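(* Let $\beta>0$ be real, and let $X_1,\dots,X_n$ be independent random variables such that $\mathsf{E} X_i\le0$ for all $i$, $\sum_{i=1}^n\mathsf{E} X_i^2\le1$, and $\sum_{i=1}^n\mathsf{E}(X_i)_+^3\le\beta$. Let $S:=X_1+\dots+X_n$ and let $Z$ be a standard normal random variable. Then for any $p\in(0,3)$ and any real $a>0$ $$\mathsf{E} S_+^p\le\frac{p^p(3-p)^{3-p}}{3^3}\,\frac{\mathsf{E}(Z+a)_+^3+\beta}{a^{3-p}}.$$ In particular (taking $(p,a)=(1,\tfrac{1746}{1000})$ and $(p,a)=(2,\tfrac{639}{1000})$, respectively), $$\mathsf{E} S_+\le0.514+0.0486\,\beta\qquad\text{and}\qquad\mathsf{E} S_+^2\le0.555+0.232\,\beta.$$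
   Context: Notation: $x_+:=\max(0,x)$ and $x_+^p:=(x_+)^p$ for real $x$ and real $p>0$. *)

(* Defs.v *)
From HB Require Import structures.
From mathcomp Require Import all_boot all_order all_algebra.
From mathcomp Require Import all_classical all_reals all_analysis.

Set Implicit Arguments.
Unset Strict Implicit.
Unset Printing Implicit Defensive.

Import Order.TTheory GRing.Theory Num.Theory.

Local Open Scope classical_set_scope.
Local Open Scope ring_scope.

Definition pospart (R : realType) (x : R) : R := Num.max 0 x.

Definition mutually_independent (d d' : measure_display) (T : measurableType d)
    (T' : measurableType d') (R : realType) (P : probability T R)
    (I : finType) (X : I -> {RV P >-> T'}) : Prop :=
  forall (J : {set I}) (A : I -> set T'),
    (forall i, i \in J -> measurable (A i)) ->
    P (\bigcap_(i in [set` J]) (X i @^-1` A i)) =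
    (\prod_(i in J) P (X i @^-1` A i))%E.

(* Equality of laws is required on measurable sets only: the values of the two
   measures on other sets carry no meaning. *)
Definition standard_normal (d : measure_display) (T : measurableType d)
    (R : realType) (P : probability T R) (Z : {RV P >-> R}) : Prop :=
  forall A : set R, measurable A -> distribution P Z A = normal_prob 0 1 A.

(* Main.v *)
Require Import Defs.
From HB Require Import structures.
From mathcomp Require Import all_boot all_order all_algebra.
From mathcomp Require Import all_classical all_reals all_analysis.
From mathcomp Require Import measurable_realfun ring lra.

Set Implicit Arguments.
Unset Strict Implicit.
Unset Printing Implicit Defensive.

Import Order.TTheory GRing.Theory Num.Theory.
Import numFieldNormedType.Exports.

Local Open Scope classical_set_scope.
Local Open Scope ring_scope.

(* Lindeberg's replacement argument for [f x = (x + a)_+ ^ 3]. Since [f' >= 0]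
   and [0 <= f^(3) <= 6], a summand [X] with nonpositive mean changes the
   expectation by at most [E f'' * E X ^ 2 / 2 + E X_+ ^ 3]; since [f''] is
   convex, a centered Gaussian increment of the same variance changes it by at
   least [E f'' * E X ^ 2 / 2]. Hence [E (S + a)_+ ^ 3 <= E (Z + a)_+ ^ 3 + beta],
   and the bound on [E S_+ ^ p] follows from the weighted AM-GM inequality
   [x ^ p <= p ^ p (3 - p) ^ (3 - p) / 27 * (x + a) ^ 3 / a ^ (3 - p)]. Gaussian
   random variables are never added: the Gaussian increments are handled through
   the closed form of [E (x + t Z)_+ ^ 3] and the heat equation that it
   satisfies in the variables [x] and [t ^ 2]. *)

(* [is_derive] is a class, and its instances are stated for pointwise operations
   on functions; this copy is not a class, so that applying a rule to a lambda
   term never triggers instance resolution. *)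
Definition has_deriv (R : realType) (f : R -> R) (x a : R) : Prop :=
  is_derive x 1 f a.

(** * Rules of differentiation *)

Section derivation.
Context {R : realType}.
Implicit Types (f g df : R -> R) (x a b : R).

Lemma has_deriv_cst c x : has_deriv (fun _ : R => c : R) x 0.
Proof. exact: is_derive_cst. Qed.

Lemma has_deriv_id x : has_deriv (fun y : R => y) x 1.
Proof. exact: is_derive_id. Qed.

Lemma has_derivD f g x a b : has_deriv f x a -> has_deriv g x b ->
  has_deriv (fun y => f y + g y) x (a + b).
Proof. exact: is_deriveD. Qed.

Lemma has_derivN f x a : has_deriv f x a -> has_deriv (fun y => - f y) x (- a).
Proof. exact: is_deriveN. Qed.

Lemma has_derivM f g x a b : has_deriv f x a -> has_deriv g x b ->
  has_deriv (fun y => f y * g y) x (f x * b + g x * a).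
Proof. exact: is_deriveM. Qed.

Lemma has_derivX f n x a : has_deriv f x a ->
  has_deriv (fun y => f y ^+ n) x (n%:R * f x ^+ n.-1 * a).
Proof.
rewrite /has_deriv => fa.
have -> : (fun y => f y ^+ n) = f ^+ n by apply/funext => y; rewrite fctE.
exact: is_deriveX.
Qed.

Lemma has_derivV f x a : f x != 0 -> has_deriv f x a ->
  has_deriv (fun y => (f y)^-1) x (- (f x) ^- 2 * a).
Proof. by move=> fx0 fa; exact: is_deriveV. Qed.

Lemma has_deriv_comp g f x a b : has_deriv g (f x) b ->
  has_deriv f x a -> has_deriv (fun y => g (f y)) x (b * a).
Proof. exact: is_derive1_comp. Qed.

Lemma has_deriv_eq f x a b : has_deriv f x a -> a = b -> has_deriv f x b.
Proof. by move=> fa <-. Qed.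

Lemma has_deriv_continuous f df : (forall x, has_deriv f x (df x)) ->
  continuous f.
Proof.
move=> fdf x; apply/differentiable_continuous/derivable1_diffP.
by have [] := fdf x.
Qed.

Lemma deriv_ge0_le f df a b :
  (forall x, a <= x -> x <= b -> has_deriv f x (df x)) ->
  (forall x, a <= x -> x <= b -> 0 <= df x) -> a <= b -> f a <= f b.
Proof.
move=> fdf df0 ab.
have cf : {within `[a, b], continuous f}.
  apply: derivable_within_continuous => x; rewrite in_itv/= => /andP[ax xb].
  by have [] := fdf _ ax xb.
have fdf' x : x \in `]a, b[ -> is_derive x 1 f (df x).
  by rewrite in_itv/= => /andP[/ltW ax /ltW xb]; exact: fdf.
have [c] := MVT_segment ab fdf' cf.
rewrite in_itv/= => /andP[ac cb] fE.
by rewrite -subr_ge0 fE mulr_ge0 ?subr_ge0// df0.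
Qed.

End derivation.

(** The first four cases of the match catch functions in eta-contracted form, such as [*%R c] for
    [fun y => c * y]; the last two use derivatives known in the context. *)
Ltac derive_rules := repeat first
  [ eassumption
  | lazymatch goal with
    | |- has_deriv ( *%R ?c) _ _ => apply: (has_derivM (f := fun=> c))
    | |- has_deriv (+%R ?c) _ _ => apply: (has_derivD (f := fun=> c))
    | |- has_deriv -%R _ _ => apply: (has_derivN (f := fun y => y))
    | |- has_deriv (@GRing.inv _) _ _ => apply: (has_derivV (f := fun y => y))
    | |- has_deriv (fun _ => ?c) _ _ => apply: has_deriv_cst
    | |- has_deriv (fun y => y) _ _ => apply: has_deriv_id
    | |- has_deriv (fun y => _ + _) _ _ => apply: has_derivD
    | |- has_deriv (fun y => - _) _ _ => apply: has_derivN
    | |- has_deriv (fun y => _ * _) _ _ => apply: has_derivM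
    | |- has_deriv (fun y => _ ^+ _) _ _ => apply: has_derivX
    | |- has_deriv (fun y => (_)^-1) _ _ => apply: has_derivV
    | H : forall x : _, has_deriv ?f x _ |- has_deriv (fun y => ?f _) _ _ =>
        apply: (has_deriv_comp (g := f)); first exact: H
    | H : forall x : _, has_deriv ?f x _ |- has_deriv ?f _ _ => exact: H
    end ].

(** * The standard normal distribution function *)

Section gaussian.
Context {R : realType}.
Implicit Types x y : R.

Definition gpdf : R -> R := normal_pdf 0 1.

Definition gcdf x : R := fine (normal_prob 0 1 `]-oo, x]).

Lemma gpdfE x : gpdf x = gpdf 0 * expR (- (x ^+ 2 / 2)).
Proof.
rewrite /gpdf normal_pdfE ?oner_neq0// /normal_fun !subr0 expr1n.
by rewrite mulNr expr0n/= oppr0 mul0r expR0 mulr1.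
Qed.

Lemma gpdf_gt0 x : 0 < gpdf x.
Proof.
rewrite /gpdf normal_pdfE ?oner_neq0// mulr_gt0 ?expR_gt0//.
by rewrite normal_peak_gt0 ?oner_neq0.
Qed.

Lemma gpdf_ge0 x : 0 <= gpdf x. Proof. exact/ltW/gpdf_gt0. Qed.

Lemma gpdfN x : gpdf (- x) = gpdf x.
Proof. by rewrite gpdfE sqrrN -gpdfE. Qed.

Lemma has_deriv_expR x : has_deriv (@expR R) x (expR x).
Proof. exact: is_derive_expR. Qed.

Lemma has_deriv_gpdf x : has_deriv gpdf x (- (x * gpdf x)).
Proof.
have dE := has_deriv_expR.
rewrite (_ : gpdf = fun y => gpdf 0 * expR (- (y ^+ 2 / 2))); last first.
  by apply/funext => y; exact: gpdfE.
apply: has_deriv_eq; first by derive_rules.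
by rewrite /=; field.
Qed.

Lemma has_deriv_gcdf x : has_deriv gcdf x (gpdf x).
Proof.
have x1 : x < x + 1 by rewrite ltrDl.
have intf : lebesgue_measure.-integrable [set` `]-oo, (x + 1)]] (EFin \o gpdf).
  apply: integrableS (integrable_normal_pdf 0 1) => //.
have [] := continuous_FTC1 x1 intf (ltNyr _).
  exact/continuous_normal_pdf/oner_neq0.
by move=> dF FE; split; [exact: dF|rewrite -derive1E; exact: FE].
Qed.

Lemma gcdf_ge0 x : 0 <= gcdf x.
Proof. by rewrite fine_ge0. Qed.

Lemma gcdf_le1 x : gcdf x <= 1.
Proof.
rewrite -lee_fin fineK ?fin_num_measure//; exact: probability_le1.
Qed.

(** Under the normal law the identity is a random variable with distribution function [gcdf], so the
    limits of [gcdf] at infinity are those of a distribution function. *)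
Let idTR : measurableTypeR R -> R := idfun.

#[local] HB.instance Definition _ :=
  @isMeasurableFun.Build _ _ _ _ idTR (@measurable_id _ _ setT).

Let X : {RV (normal_prob 0 1 : probability (measurableTypeR R) R) >-> R} :=
  idTR.

Lemma cvg_gcdfy : gcdf x @[x --> +oo] --> (1 : R).
Proof. by have /fine_cvgP[] := cvg_cdfy1 X. Qed.

Lemma cvg_gcdfNy : gcdf x @[x --> -oo] --> (0 : R).
Proof. by have /fine_cvgP[] := cvg_cdfNy0 X. Qed.

(** Since [gpdf] is even, [g] has derivative zero; it is constant, with limit 1 at infinity. *)
Lemma gcdfN x : gcdf (- x) = 1 - gcdf x.
Proof.
pose g y := gcdf y + gcdf (- y).
have dF := has_deriv_gcdf.
have dg (y : R) : has_deriv g y 0.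
  have -> : 0 = gpdf y + gpdf (- y) * (- 1) by rewrite gpdfN mulrN1 subrr.
  rewrite /g; derive_rules.
have dgN (y : R) : has_deriv (fun y => - g y) y 0.
  by apply: has_deriv_eq; [derive_rules|rewrite oppr0].
have gE y : 0 <= y -> g y = g 0.
  move=> y0; apply/eqP; rewrite eq_le -lerN2 andbC.
  rewrite (deriv_ge0_le (fun z _ _ => dg z))//.
  by rewrite (deriv_ge0_le (fun z _ _ => dgN z)).
have g1 : g y @[y --> +oo] --> (1 : R).
  rewrite -[X in _ --> X]addr0; apply: cvgD; first exact: cvg_gcdfy.
  by move/cvgNy_compNP : cvg_gcdfNy.
have g01 : g 0 = 1.
  apply: (cvg_unique _ _ g1) => //.
  apply: cvg_near_cst; near=> y; apply: gE; near: y; exact: nbhs_pinfty_ge.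
suff : g x = 1 by rewrite /g => <-; rewrite addrC addKr.
have [x0|/ltW x0] := leP 0 x; first by rewrite gE.
by rewrite -g01 -[in RHS](gE (- x)) ?oppr_ge0// /g opprK addrC.
Unshelve. all: by end_near. Qed.

End gaussian.

(** * Positive-part moments of a Gaussian variable *)

Section gaussian_moments.
Context {R : realType}.
Implicit Types x y h u : R.
Notation gpdf := (@gpdf R).
Notation gcdf := (@gcdf R).

(* [gposk y] is [E (Z + y)_+ ^ k] for [Z] standard normal. *)
Definition gpos1 y := y * gcdf y + gpdf y.
Definition gpos2 y := (y ^+ 2 + 1) * gcdf y + y * gpdf y.
Definition gpos3 y := (y ^+ 3 + 3 * y) * gcdf y + (y ^+ 2 + 2) * gpdf y.

Lemma has_deriv_gpos1 y : has_deriv gpos1 y (gcdf y).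
Proof.
have := (@has_deriv_gpdf R, @has_deriv_gcdf R) => -[dp dc].
rewrite /gpos1; apply: has_deriv_eq; first by derive_rules.
by rewrite /=; ring.
Qed.

Lemma has_deriv_gpos2 y : has_deriv gpos2 y (2 * gpos1 y).
Proof.
have := (@has_deriv_gpdf R, @has_deriv_gcdf R) => -[dp dc].
rewrite /gpos2 /gpos1; apply: has_deriv_eq; first by derive_rules.
by rewrite /=; ring.
Qed.

Lemma has_deriv_gpos3 y : has_deriv gpos3 y (3 * gpos2 y).
Proof.
have := (@has_deriv_gpdf R, @has_deriv_gcdf R) => -[dp dc].
rewrite /gpos3 /gpos2; apply: has_deriv_eq; first by derive_rules.
by rewrite /=; ring.
Qed.

(** This expresses [E Y_+ ^ 3 - E (- Y)_+ ^ 3 = E Y ^ 3] for [Y = Z + y], as [Z] is symmetric. *)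
Lemma gpos3N y : gpos3 (- y) = gpos3 y - (y ^+ 3 + 3 * y).
Proof. by rewrite /gpos3 gcdfN gpdfN; ring. Qed.

(** The term of degree [n + 1] in the series of [expR (y ^ 2 / 2)] bounds the function by [C / y]
    once [y >= 1]. *)
Lemma cvg_gpdfX n : y ^+ n * gpdf y @[y --> +oo] --> (0 : R).
Proof.
have g0 := gpdf_gt0 (0 : R).
pose C : R := 2 ^+ n.+1 * n.+1`!%:R * gpdf 0.
apply: (@squeeze_cvgr _ _ _ _ (fun=> 0) (fun y => C / y)); last 2 first.
- exact: cvg_cst.
- rewrite -[X in _ --> X](mulr0 C); apply: cvgM; first exact: cvg_cst.
  by apply/gtr0_cvgV0; [exact: nbhs_pinfty_gt|exact: cvg_id].
near=> y; have y1 : 1 <= y by near: y; exact: nbhs_pinfty_ge.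
have y0 : 0 < y by rewrite (lt_le_trans ltr01).
rewrite mulr_ge0 ?exprn_ge0 ?gpdf_ge0 ?(ltW y0)//=.
have u0 : 0 <= y ^+ 2 / 2 by rewrite divr_ge0// sqr_ge0.
have ge : (y ^+ 2 / 2) ^+ n.+1 / n.+1`!%:R <= expR (y ^+ 2 / 2).
  by rewrite (le_trans _ (expR_ge1Dxn n u0))// lerDr.
pose K : R := 2 ^+ n.+1 * n.+1`!%:R.
have K0 : 0 < K by rewrite mulr_gt0 ?exprn_gt0// ltr0n fact_gt0.
have yE : y ^+ n.+1 <= K * expR (y ^+ 2 / 2).
  rewrite -ler_pdivrMl//; apply: le_trans ge.
  rewrite expr_div_n -exprM -mulrA -invfM [leRHS]mulrC.
  by rewrite ler_wpM2l ?invr_ge0 ?(ltW K0)// ler_weXn2l// mul2n -addnn leq_addr.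
rewrite ler_pdivlMr// gpdfE expRN mulrCA -mulrA mulrAC -exprSr mulrC.
by rewrite ler_wpM2r ?(ltW g0)// ler_pdivrMr ?expR_gt0.
Unshelve. all: by end_near. Qed.

(** The difference has derivative [(x - 1) * gpdf x], so on [[1, +oo[] it increases to its limit
    0. *)
Lemma gcdf_tail_le y : 1 <= y -> gcdf (- y) <= gpdf y.
Proof.
move=> y1.
have dp := @has_deriv_gpdf R; have dc := @has_deriv_gcdf R.
pose g x := gcdf (- x) - gpdf x.
have dg x : has_deriv g x ((x - 1) * gpdf x).
  by apply: has_deriv_eq; [rewrite /g; derive_rules|rewrite /= gpdfN; ring].
have gle x : y <= x -> g y <= g x.
  apply: (deriv_ge0_le (fun z _ _ => dg z)) => z yz _.
  by rewrite mulr_ge0 ?gpdf_ge0// subr_ge0 (le_trans y1).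
have g0 : g x @[x --> +oo] --> (0 : R).
  rewrite -[X in _ --> X](subr0 0); apply: cvgB.
    by move/cvgNy_compNP : (@cvg_gcdfNy R).
  apply: cvg_trans (cvg_gpdfX 0); apply: near_eq_cvg; apply: nearW => z.
    by rewrite expr0 mul1r.
rewrite -subr_le0 -/(g y); apply: (cvgr_to_ge g0).
near=> x; apply: gle; near: x; exact: nbhs_pinfty_ge (num_real y).
Unshelve. all: by end_near. Qed.

Lemma cvg_gcdf_tailX n : y ^+ n * gcdf (- y) @[y --> +oo] --> (0 : R).
Proof.
apply: (@squeeze_cvgr _ _ _ _ (fun=> 0) (fun y => y ^+ n * gpdf y)).
- near=> y; have y1 : 1 <= y by near: y; exact: nbhs_pinfty_ge.
  have yn0 : 0 <= y ^+ n by rewrite exprn_ge0 ?(le_trans ler01).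
  by rewrite mulr_ge0 ?gcdf_ge0//= ler_wpM2l ?gcdf_tail_le.
- exact: cvg_cst.
- exact: cvg_gpdfX.
Unshelve. all: by end_near. Qed.

(** Lifts nonnegativity from [gcdf] to [gpos1], [gpos2] and [gpos3] in turn. *)
Lemma deriv_ge0_cvgNy_ge0 (f df : R -> R) y :
  (forall x, has_deriv f x (df x)) -> (forall x, 0 <= df x) ->
  f (- x) @[x --> +oo] --> (0 : R) -> 0 <= f y.
Proof.
move=> fdf df0 fNy; apply: (cvgr_to_le fNy).
near=> x; apply: (deriv_ge0_le (fun z _ _ => fdf z)) => //.
by rewrite lerNl; near: x; exact: nbhs_pinfty_ge (num_real _).
Unshelve. all: by end_near. Qed.

Lemma gpos1_ge0 y : 0 <= gpos1 y.
Proof.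
apply: (deriv_ge0_cvgNy_ge0 _ has_deriv_gpos1) => [x|]; first exact: gcdf_ge0.
rewrite [X in X @ _](_ : _ = fun x =>
    - (x ^+ 1 * gcdf (- x)) + x ^+ 0 * gpdf x); last first.
  by apply/funext => x; rewrite /gpos1 gpdfN; ring.
have -> : 0 = - 0 + 0 :> R by ring.
by apply: cvgD; [apply: cvgN; exact: cvg_gcdf_tailX|exact: cvg_gpdfX].
Qed.

Lemma gpos2_ge0 y : 0 <= gpos2 y.
Proof.
apply: (deriv_ge0_cvgNy_ge0 _ has_deriv_gpos2) => [x|].
  by rewrite mulr_ge0 ?gpos1_ge0.
rewrite [X in X @ _](_ : _ = fun x => x ^+ 2 * gcdf (- x)
    + x ^+ 0 * gcdf (- x) - x ^+ 1 * gpdf x); last first.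
  by apply/funext => x; rewrite /gpos2 gpdfN; ring.
have -> : 0 = 0 + 0 - 0 :> R by ring.
apply: cvgB; last exact: cvg_gpdfX.
by apply: cvgD; exact: cvg_gcdf_tailX.
Qed.

Lemma gpos3_ge0 y : 0 <= gpos3 y.
Proof.
apply: (deriv_ge0_cvgNy_ge0 _ has_deriv_gpos3) => [x|].
  by rewrite mulr_ge0 ?gpos2_ge0.
rewrite [X in X @ _](_ : _ = fun x =>
    - (x ^+ 3 * gcdf (- x) + 3 * (x ^+ 1 * gcdf (- x)))
    + (x ^+ 2 * gpdf x + 2 * (x ^+ 0 * gpdf x))); last first.
  by apply/funext => x; rewrite /gpos3 gpdfN; ring.
have -> : 0 = - (0 + 3 * 0) + (0 + 2 * 0) :> R by ring.
apply: cvgD; first apply: cvgN; apply: cvgD;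
  [exact: cvg_gcdf_tailX| |exact: cvg_gpdfX|];
  (apply: cvgM; first exact: cvg_cst); [exact: cvg_gcdf_tailX|exact: cvg_gpdfX].
Qed.


End gaussian_moments.

(** * Taylor bounds and heat flow for the Gaussian moments *)

Section gaussian_moments_evolution.
Context {R : realType}.
Implicit Types x y h u t : R.

Lemma gpos1_homo x y : x <= y -> gpos1 x <= gpos1 y.
Proof.
apply: (deriv_ge0_le (fun z _ _ => has_deriv_gpos1 z)) => z _ _.
exact: gcdf_ge0.
Qed.

(** The third derivative of [gpos3] is [6 * gcdf <= 6]; [r2], [r1] and [r0] integrate this bound
    three times from 0. *)
Lemma gpos3_taylor_ge0 u h : 0 <= h ->
  gpos3 (u + h) <= gpos3 u + 3 * h * gpos2 u + 3 * h ^+ 2 * gpos1 u + h ^+ 3.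
Proof.
have d1 := @has_deriv_gpos1 R; have d2 := @has_deriv_gpos2 R.
have d3 := @has_deriv_gpos3 R.
pose r2 h := gpos1 u + h - gpos1 (u + h).
pose r1 h := gpos2 u + 2 * h * gpos1 u + h ^+ 2 - gpos2 (u + h).
pose r0 h :=
  gpos3 u + 3 * h * gpos2 u + 3 * h ^+ 2 * gpos1 u + h ^+ 3 - gpos3 (u + h).
have dr2 x : has_deriv r2 x (1 - gcdf (u + x)).
  by rewrite /r2; apply: has_deriv_eq; [derive_rules|rewrite /=; ring].
have dr1 x : has_deriv r1 x (2 * r2 x).
  by rewrite /r1; apply: has_deriv_eq; [derive_rules|rewrite /= /r2; ring].
have dr0 x : has_deriv r0 x (3 * r1 x).
  by rewrite /r0; apply: has_deriv_eq; [derive_rules|rewrite /= /r1; ring].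
have r2_ge0 x : 0 <= x -> 0 <= r2 x.
  move=> x0; have -> : 0 = r2 0 by rewrite /r2 !addr0 subrr.
  apply: (deriv_ge0_le (fun z _ _ => dr2 z)) => // z _ _.
  by rewrite subr_ge0 gcdf_le1.
have r1_ge0 x : 0 <= x -> 0 <= r1 x.
  move=> x0; have -> : 0 = r1 0 by rewrite /r1 !addr0; ring.
  apply: (deriv_ge0_le (fun z _ _ => dr1 z)) => // z z0 _.
  by rewrite mulr_ge0 ?r2_ge0.
move=> h0; rewrite -subr_ge0 -/(r0 h).
have -> : 0 = r0 0 by rewrite /r0 !addr0; ring.
apply: (deriv_ge0_le (fun z _ _ => dr0 z)) => // z z0 _.
by rewrite mulr_ge0 ?r1_ge0.
Qed.

(** For [h <= 0] the remainder after the quadratic term is nonpositive, because [gpos1] is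
    nondecreasing. *)
Lemma gpos3_taylor_le0 u h : h <= 0 ->
  gpos3 (u + h) <= gpos3 u + 3 * h * gpos2 u + 3 * h ^+ 2 * gpos1 u.
Proof.
have d1 := @has_deriv_gpos1 R; have d2 := @has_deriv_gpos2 R.
have d3 := @has_deriv_gpos3 R.
pose r1 h := gpos2 u + 2 * h * gpos1 u - gpos2 (u + h).
pose r0 h := gpos3 (u + h) - (gpos3 u + 3 * h * gpos2 u + 3 * h ^+ 2 * gpos1 u).
have dr1 x : has_deriv r1 x (2 * (gpos1 u - gpos1 (u + x))).
  by rewrite /r1; apply: has_deriv_eq; [derive_rules|rewrite /=; ring].
have dr0 x : has_deriv r0 x (3 * - r1 x).
  by rewrite /r0; apply: has_deriv_eq; [derive_rules|rewrite /= /r1; ring].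
have r1_le0 x : x <= 0 -> r1 x <= 0.
  move=> x0; have -> : 0 = r1 0 by rewrite /r1 !addr0; ring.
  apply: (deriv_ge0_le (fun z _ _ => dr1 z)) => // z _ z0.
  by rewrite mulr_ge0// subr_ge0 gpos1_homo// gerDl.
move=> h0; rewrite -subr_le0 -/(r0 h).
have -> : 0 = r0 0 by rewrite /r0 !addr0; ring.
apply: (deriv_ge0_le (fun z _ _ => dr0 z)) => // z _ z0.
by rewrite mulr_ge0// oppr_ge0 r1_le0.
Qed.

(** Only the positive part of [h] enters the cubic error, which matches the hypothesis on
    [E (X_i)_+ ^ 3]. *)
Lemma gpos3_taylor u h : gpos3 (u + h) <=
  gpos3 u + 3 * h * gpos2 u + 3 * h ^+ 2 * gpos1 u + pospart h ^+ 3.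
Proof.
rewrite /pospart; have [h0|/ltW h0] := leP 0 h.
  exact: gpos3_taylor_ge0.
by rewrite expr0n addr0; exact: gpos3_taylor_le0.
Qed.

(* [gaussk x t] is [E (x + t Z)_+ ^ k], the solution at time [t ^ 2] of the heat
   equation started from [x_+ ^ k]. *)
Definition gauss1 x t := if t == 0 then pospart x else t * gpos1 (x / t).
Definition gauss2 x t :=
  if t == 0 then pospart x ^+ 2 else t ^+ 2 * gpos2 (x / t).
Definition gauss3 x t :=
  if t == 0 then pospart x ^+ 3 else t ^+ 3 * gpos3 (x / t).

Lemma pospart_ge0 x : 0 <= pospart x.
Proof. by rewrite /pospart le_max lexx. Qed.

Lemma gauss1_ge0 x t : 0 <= t -> 0 <= gauss1 x t.
Proof.
move=> t0; rewrite /gauss1; case: ifP => _; first exact: pospart_ge0.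
by rewrite mulr_ge0 ?gpos1_ge0.
Qed.

Lemma gauss2_ge0 x t : 0 <= t -> 0 <= gauss2 x t.
Proof.
move=> t0; rewrite /gauss2; case: ifP => _.
  by rewrite exprn_ge0 ?pospart_ge0.
by rewrite mulr_ge0 ?exprn_ge0 ?gpos2_ge0.
Qed.

Lemma gauss3_ge0 x t : 0 <= t -> 0 <= gauss3 x t.
Proof.
move=> t0; rewrite /gauss3; case: ifP => _.
  by rewrite exprn_ge0 ?pospart_ge0.
by rewrite mulr_ge0 ?exprn_ge0 ?gpos3_ge0.
Qed.

Lemma pospartM x t : 0 <= t -> pospart (t * x) = t * pospart x.
Proof. by move=> t0; rewrite /pospart maxr_pMr// mulr0. Qed.

(** The case [t = 0] of [gauss3_taylor], settled by signs since [x_+ ^ 3] has no third derivative at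
    0. *)
Lemma pospart_cube_taylor x y : pospart (x + y) ^+ 3 <=
  pospart x ^+ 3 + 3 * y * pospart x ^+ 2 + 3 * y ^+ 2 * pospart x
  + pospart y ^+ 3.
Proof.
have cube_ge0 (z : R) : 0 <= z -> 0 <= z ^+ 3 by move=> ?; rewrite exprn_ge0.
rewrite /pospart; case: (leP 0 x) => x0; case: (leP 0 y) => y0;
  case: (leP 0 (x + y)) => xy0.
- by rewrite le_eqVlt; apply/orP; left; apply/eqP; ring.
- by lra.
- rewrite -subr_ge0 (_ : _ - _ = (- y) ^+ 3); last by ring.
  by apply: cube_ge0; lra.
(* Here [y < 0 <= x] and [x + y < 0]: the left side is 0, and the right side is [x] times a
   quadratic form written as a sum of squares. *)
- rewrite !expr0n /= addr0 (_ : _ + _ =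
    x * ((x + 3 / 2 * y) ^+ 2 + 3 / 4 * y ^+ 2)); last by field.
  rewrite mulr_ge0//.
  by have := sqr_ge0 (x + 3 / 2 * y); have := sqr_ge0 y; lra.
- rewrite !expr0n /= !mulr0 !add0r lerXn2r ?nnegrE//; lra.
- by rewrite !expr0n /= !mulr0 !add0r cube_ge0.
- by lra.
- by rewrite !expr0n /= !mulr0 !addr0.
Qed.

(** By homogeneity, for [t > 0] this is [t ^ 3] times [gpos3_taylor] at [x / t] and [y / t]. *)
Lemma gauss3_taylor x y t : 0 <= t -> gauss3 (x + y) t <=
  gauss3 x t + 3 * y * gauss2 x t + 3 * y ^+ 2 * gauss1 x t + pospart y ^+ 3.
Proof.
move=> t0; rewrite /gauss1 /gauss2 /gauss3; case: eqP => [_|/eqP tn0].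
  exact: pospart_cube_taylor.
have t3 : 0 <= t ^+ 3 by rewrite exprn_ge0.
have := ler_wpM2l t3 (gpos3_taylor (x / t) (y / t)).
rewrite -mulrDl => /le_trans; apply.
have -> : pospart (y / t) = pospart y / t.
  by rewrite mulrC pospartM ?invr_ge0// mulrC.
by rewrite le_eqVlt; apply/orP; left; apply/eqP; field.
Qed.

(** For [y >= 0] the difference is [gpos3 (- y)]. After scaling, this is [gauss3_heat] at
    [t = 0]. *)
Lemma gpos3_ge_pospart y : pospart y ^+ 3 + 3 * pospart y <= gpos3 y.
Proof.
rewrite /pospart; case: (leP 0 y) => [y0|_].
  by have := gpos3_ge0 (- y); rewrite gpos3N subr_ge0.
by rewrite expr0n mulr0 addr0 gpos3_ge0.
Qed.

(** The derivative in [r] is [gpdf (x / r)]. In probabilistic terms, [E (x + r Z)_+] grows with [r]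
    because [x_+] is convex. *)
Lemma scaled_gpos1_homo x t r : 0 < t -> t <= r ->
  t * gpos1 (x / t) <= r * gpos1 (x / r).
Proof.
move=> t0; have d1 := @has_deriv_gpos1 R.
apply: (@deriv_ge0_le _ (fun r => r * gpos1 (x / r)) (fun r => gpdf (x / r))).
  move=> z tz _; have z0 : z != 0 by rewrite gt_eqF// (lt_le_trans t0).
  by apply: has_deriv_eq; [derive_rules|rewrite /gpos1 /=; field].
by move=> z _ _; exact: gpdf_ge0.
Qed.

(** By the heat equation, [z ^ 3 * gpos3 (x / z)] has derivative [6 * z * (z * gpos1 (x / z))] in
    [z]; the last factor is at least its value [D] at [z = t]. *)
Lemma scaled_gpos3_heat x t r : 0 < t -> t <= r ->
  t ^+ 3 * gpos3 (x / t) + 3 * (r ^+ 2 - t ^+ 2) * (t * gpos1 (x / t))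
    <= r ^+ 3 * gpos3 (x / r).
Proof.
move=> t0 tr; have d3 := @has_deriv_gpos3 R.
pose D := t * gpos1 (x / t).
pose f z := z ^+ 3 * gpos3 (x / z) - 3 * z ^+ 2 * D.
suff : f t <= f r by rewrite /f -/D; lra.
apply: (@deriv_ge0_le _ f (fun z => 6 * z * (z * gpos1 (x / z) - D)))
  => [z tz _|z tz _|]; last exact: tr.
- have z0 : z != 0 by rewrite gt_eqF// (lt_le_trans t0).
  rewrite /f; apply: has_deriv_eq; first by derive_rules.
  rewrite /= /gpos1 /gpos2 /gpos3.
  by move: (gcdf (x / z)) (gpdf (x / z)) => c p; field.
- have z0 : 0 <= z by rewrite (le_trans (ltW t0)).
  by rewrite mulr_ge0 ?mulr_ge0// subr_ge0 scaled_gpos1_homo.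
Qed.

(** The gain [3 * s * gauss1 x t] is exactly the mean of the quadratic term of [gauss3_taylor] for a
    summand with second moment [s]. *)
Lemma gauss3_heat x t s : 0 <= t -> 0 <= s ->
  gauss3 x t + 3 * s * gauss1 x t <= gauss3 x (Num.sqrt (t ^+ 2 + s)).
Proof.
rewrite le_eqVlt => /predU1P[<-|t0] s0; last first.
  have ts0 : 0 <= t ^+ 2 + s by rewrite addr_ge0 ?sqr_ge0.
  have tr : t <= Num.sqrt (t ^+ 2 + s).
    by rewrite -{1}(gtr0_norm t0) -sqrtr_sqr ler_wsqrtr// lerDl.
  have r0 : 0 < Num.sqrt (t ^+ 2 + s) by exact: lt_le_trans tr.
  rewrite /gauss3 /gauss1 !gt_eqF//.
  by have := scaled_gpos3_heat x t0 tr; rewrite sqr_sqrtr// addrAC subrr add0r.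
rewrite /gauss1 /gauss3 eqxx expr0n add0r.
have [->|sn0] := eqVneq s 0; first by rewrite sqrtr0 eqxx mulr0 mul0r addr0.
have r0 : 0 < Num.sqrt s by rewrite sqrtr_gt0 lt0r sn0.
rewrite gt_eqF// -{1}(sqr_sqrtr s0).
set r := Num.sqrt s in r0 *.
have r3 : 0 <= r ^+ 3 by rewrite exprn_ge0// ltW.
apply: le_trans (ler_wpM2l r3 (gpos3_ge_pospart (x / r))).
have -> : pospart (x / r) = pospart x / r.
  by rewrite mulrC pospartM ?invr_ge0 ?(ltW r0)// mulrC.
by rewrite le_eqVlt; apply/orP; left; apply/eqP; field; rewrite gt_eqF.
Qed.

(** Run the heat flow for the remaining time [1 - t ^ 2] and drop the nonnegative gain. *)
Lemma gauss3_le_gpos3 x t : 0 <= t -> t <= 1 -> gauss3 x t <= gpos3 x.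
Proof.
move=> t0 t1; have s0 : 0 <= 1 - t ^+ 2 by rewrite subr_ge0 expr_le1.
have := gauss3_heat x t0 s0.
rewrite subrKC sqrtr1 {2}/gauss3 oner_eq0 expr1n mul1r divr1.
by apply: le_trans; rewrite lerDl !mulr_ge0 ?gauss1_ge0.
Qed.

Lemma measurable_gauss3 t : measurable_fun setT (gauss3 ^~ t).
Proof.
rewrite /gauss3; case: (t == 0) => /=.
  by apply: measurable_funX; apply: measurable_maxr.
apply: measurable_funM => //; apply: measurableT_comp.
  apply: continuous_measurable_fun.
  exact: (has_deriv_continuous (@has_deriv_gpos3 R)).
exact: measurable_funM.
Qed.

End gaussian_moments_evolution.

(** * Expectations under the normal law *)

Section normal_expectation.
Context {R : realType}.
Notation mu := (@lebesgue_measure R).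

(** The Radon-Nikodym derivative of the normal law agrees with [gpdf] almost everywhere, both having
    the same integral over every measurable set. *)
Lemma ge0_integral_normal_prob (f : R -> \bar R) :
  (forall x, 0 <= f x)%E -> measurable_fun setT f ->
  (\int[normal_prob 0 1]_x f x = \int[mu]_x (f x * (gpdf x)%:E))%E.
Proof.
move=> f0 mf; have dom := @normal_prob_dominates R 0 1.
have mg : measurable_fun setT (fun x : R => (gpdf x)%:E).
  by apply/measurable_EFinP; exact: measurable_normal_pdf.
rewrite -(Radon_Nikodym_SigmaFinite.change_of_variables dom f0)//.
have mr := Radon_Nikodym_SigmaFinite.f_integrable dom.
apply: ae_eq_integral => //.
- by apply: emeasurable_funM => //; exact: measurable_int mr.
- exact: emeasurable_funM.
- apply: ae_eqe_mul2l; apply: integral_ae_eq => //.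
  by move=> E _ mE; rewrite -(Radon_Nikodym_SigmaFinite.f_integral dom).
Qed.

Lemma integral_pospart_cube_gpdf (a : R) :
  (\int[mu]_(x in `[(- a)%R, +oo[) ((x + a) ^+ 3 * gpdf x)%R%:E
   = (gpos3 a)%:E)%E.
Proof.
have dp := @has_deriv_gpdf R; have dc := @has_deriv_gcdf R.
(* An antiderivative found by parts from [gpdf' = - x * gpdf]; at [+oo] only the [gcdf] term
   survives. *)
pose F x := (a ^+ 3 + 3 * a) * gcdf x -
  (x ^+ 2 + 2 + 3 * a * x + 3 * a ^+ 2) * gpdf x.
have dF x : has_deriv F x ((x + a) ^+ 3 * gpdf x).
  rewrite /F; apply: has_deriv_eq; first by derive_rules.
  by rewrite /=; move: (gcdf x) (gpdf x) => c p; ring.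
have Foo : F x @[x --> +oo] --> a ^+ 3 + 3 * a.
  rewrite [X in X @ _](_ : _ = fun x => (a ^+ 3 + 3 * a) * gcdf x -
      (x ^+ 2 * gpdf x + 3 * a * (x ^+ 1 * gpdf x)
       + (2 + 3 * a ^+ 2) * (x ^+ 0 * gpdf x))); last first.
    by apply/funext => x; rewrite /F; move: (gcdf x) (gpdf x) => c p; ring.
  rewrite [X in _ --> X](_ : _ = (a ^+ 3 + 3 * a) * 1 -
      (0 + 3 * a * 0 + (2 + 3 * a ^+ 2) * 0)); last by ring.
  apply: cvgB; first by apply: cvgM; [exact: cvg_cst|exact: cvg_gcdfy].
  have X n := @cvg_gpdfX R n.
  apply: cvgD; last by apply: cvgM; [exact: cvg_cst|exact: X].
  by apply: cvgD; [exact: X|apply: cvgM; [exact: cvg_cst|exact: X]].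
have cF : continuous F by exact: has_deriv_continuous dF.
rewrite (@ge0_continuous_FTC2y _ _ F _ (a ^+ 3 + 3 * a)).
- rewrite -EFinB /F gcdfN gpdfN /gpos3; congr EFin.
  by move: (gcdf a) (gpdf a) => c p; ring.
- by move=> x xa; rewrite mulr_ge0 ?gpdf_ge0// exprn_ge0//; lra.
- apply: continuous_subspaceT => x; apply: cvgM.
    apply: (@has_deriv_continuous _ (fun x => (x + a) ^+ 3)
      (fun x => 3 * (x + a) ^+ 2)) => z.
    by apply: has_deriv_eq; [derive_rules|rewrite /=; ring].
  exact: has_deriv_continuous dp x.
- exact: Foo.
- by move=> x _; have [] := dF x.
- exact/cvg_at_right_filter/cF.
- by move=> x _; rewrite derive1E; have [_ ->] := dF x.
Qed.

Lemma gpos3_le_expectation d (T : measurableType d) (Q : probability T R)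
    (Z : {RV Q >-> R}) (a : R) : standard_normal Z ->
  ((gpos3 a)%:E <= 'E_Q[fun w => (pospart (Z w + a) ^+ 3)%R])%E.
Proof.
move=> hZ; rewrite unlock.
pose f (x : R) := ((pospart (x + a)) ^+ 3)%:E.
have mf : measurable_fun setT f.
  apply/measurable_EFinP/measurable_funX; apply: measurable_maxr => //.
  exact: measurable_funD.
have f0 x : (0 <= f x)%E by rewrite lee_fin exprn_ge0 ?pospart_ge0.
(* [R] and [measurableTypeR R] have the same measurable sets but different
   displays. *)
pose idR : measurableTypeR R -> R := idfun.
have midR : measurable_fun setT idR by exact: measurable_id.
have -> : (\int[Q]_w (pospart (Z w + a) ^+ 3)%:E =
    \int[normal_prob 0 1]_x f x)%E.
  transitivity (\int[distribution Q Z]_x f x)%E.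
    by rewrite ge0_integral_distribution.
  transitivity (\int[pushforward (normal_prob 0 1) idR]_x f x)%E.
    by apply: eq_measure_integral => A mA _; exact: hZ.
  by rewrite (ge0_integral_pushforward midR).
rewrite ge0_integral_normal_prob// -integral_pospart_cube_gpdf.
have mg : measurable_fun setT (fun x : R => (f x * (gpdf x)%:E)%E).
  apply: emeasurable_funM => //; apply/measurable_EFinP.
  exact: measurable_normal_pdf.
(* The integrand is nonnegative, so restricting to [[- a, +oo[] bounds the integral from below. *)
rewrite [leLHS](_ : _ = \int[mu]_(x in `[(- a)%R, +oo[) (f x * (gpdf x)%:E))%E.
  apply: ge0_subset_integral => // x _.
  by rewrite mule_ge0// lee_fin gpdf_ge0.
apply: eq_integral => x; rewrite inE/= in_itv/= andbT => xa.
by rewrite /f /pospart -EFinM max_r//; lra.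
Qed.

End normal_expectation.

(** * The Lindeberg replacement *)

Section lindeberg_step.
Context {R : realType} d (T : measurableType d) (P : probability T R).

Lemma integrable_of_sqr (X : {RV P >-> R}) (s : R) :
  ('E_P[fun w => (X w ^+ 2)%R] = s%:E)%E -> P.-integrable setT (EFin \o X).
Proof.
rewrite unlock => X2.
have mX2 : measurable_fun setT (fun w => (X w ^+ 2)%:E).
  exact/measurable_EFinP/measurable_funX.
have iX2 : P.-integrable setT (fun w => (X w ^+ 2)%:E).
  apply/integrableP; split => //.
  under eq_integral do rewrite gee0_abs ?lee_fin ?sqr_ge0//.
  by rewrite X2 ltry.
have i1 : P.-integrable setT (EFin \o cst (1 : R)).
  exact: finite_measure_integrable_cst.
apply: le_integrable (integrableD _ i1 iX2) => //; first exact/measurable_EFinP.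
move=> w _; rewrite /= lee_fin [leRHS]ger0_norm ?addr_ge0 ?sqr_ge0//.
(* This square gives [|X| <= X ^ 2 + 1 / 4]. *)
have := sqr_ge0 (`|X w| - 1 / 2); rewrite -[X w ^+ 2]real_normK ?num_real//.
by lra.
Qed.

(** Integrate [gauss3_taylor]: the linear term is nonpositive since [gauss2 >= 0] and [E X <= 0],
    and [gauss3_heat] absorbs the quadratic term into additional Gaussian variance [s]. *)
Lemma expectation_gauss3_le (X : {RV P >-> R}) (z t s b : R) : 0 <= t ->
  ('E_P[X] <= 0)%E -> ('E_P[fun w => (X w ^+ 2)%R] = s%:E)%E ->
  ('E_P[fun w => (pospart (X w) ^+ 3)%R] = b%:E)%E ->
  ('E_P[fun w => gauss3 (z + X w) t]
     <= (gauss3 z (Num.sqrt (t ^+ 2 + s)) + b)%:E)%E.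
Proof.
move=> t0 X0 X2 X3; have iX := integrable_of_sqr X2.
move: X0 X2 X3; rewrite unlock => X0 X2 X3.
have s0 : 0 <= s.
  by rewrite -lee_fin -X2 integral_ge0// => w _; rewrite lee_fin sqr_ge0.
have mX2 : measurable_fun setT (fun w => X w ^+ 2) by exact: measurable_funX.
have mX3 : measurable_fun setT (fun w => pospart (X w) ^+ 3).
  by apply: measurable_funX; exact: measurable_maxr.
have iX2 : P.-integrable setT (fun w => (X w ^+ 2)%:E).
  apply/integrableP; split; first exact/measurable_EFinP.
  under eq_integral do rewrite gee0_abs ?lee_fin ?sqr_ge0//.
  by rewrite X2 ltry.
have p0 w : 0 <= pospart (X w) ^+ 3 by rewrite exprn_ge0 ?pospart_ge0.
have iX3 : P.-integrable setT (fun w => (pospart (X w) ^+ 3)%:E).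
  apply/integrableP; split; first exact/measurable_EFinP.
  under eq_integral do rewrite gee0_abs ?lee_fin//.
  by rewrite X3 ltry.
have ic : P.-integrable setT (EFin \o cst (gauss3 z t)).
  exact: finite_measure_integrable_cst.
pose g w := ((gauss3 z t)%:E + (3 * gauss2 z t)%:E * (X w)%:E
  + ((3 * gauss1 z t)%:E * (X w ^+ 2)%:E + (pospart (X w) ^+ 3)%:E))%E.
have i1 := integrableZl measurableT (3 * gauss2 z t) iX.
have i2 := integrableZl measurableT (3 * gauss1 z t) iX2.
have i01 := integrableD measurableT ic i1.
have i23 := integrableD measurableT i2 iX3.
have ig : P.-integrable setT g by exact: integrableD i01 i23.
apply: (@le_trans _ _ (\int[P]_w g w)%E).
  apply: ge0_le_integral => //.
  - by move=> w _; rewrite lee_fin gauss3_ge0.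
  - apply/measurable_EFinP; apply: (measurableT_comp (measurable_gauss3 t)).
    exact: measurable_funD.
  - exact: measurable_int ig.
  - move=> w _; rewrite /g -!EFinM -!EFinD lee_fin.
    by apply: le_trans (gauss3_taylor z (X w) t0) _; lra.
rewrite integralD// integralD// integralD// integralZl// integralZl//.
have -> : (\int[P]_w (EFin \o cst (gauss3 z t)) w)%E = (gauss3 z t)%:E.
  by have := expectation_cst P (gauss3 z t); rewrite unlock.
rewrite X2 X3.
have m0 : ((3 * gauss2 z t)%:E * \int[P]_x (X x)%:E <= 0)%E.
  by rewrite mule_ge0_le0// lee_fin mulr_ge0// gauss2_ge0.
apply: (@le_trans _ _
  ((gauss3 z t)%:E + 0 + ((3 * gauss1 z t)%:E * s%:E + b%:E))%E).
  by apply: leeD2r; apply: leeD2l.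
rewrite adde0 -EFinM -!EFinD lee_fin addrA lerD2r.
by apply: le_trans (gauss3_heat z t0 s0); lra.
Qed.

End lindeberg_step.

(** * Independence and product laws *)

Section independence.
Context {R : realType} d (T : measurableType d) (P : probability T R).
Local Open Scope ereal_scope.

(** Uniqueness of product measures extends the factorization from rectangles to all measurable [E].
    The event [C] is carried along so that [psum_indep] can put the later summands there. *)
Lemma joint_law (U V : {RV P >-> R}) (C : set T) : measurable C ->
  (forall A B, measurable A -> measurable B ->
    P (U @^-1` A `&` V @^-1` B `&` C) = P (U @^-1` A) * P (V @^-1` B) * P C) ->
  forall E : set (R * R), measurable E ->
  P ((fun w => (U w, V w)) @^-1` E `&` C) =
  (distribution P U \x distribution P V) E * P C.
Proof.
move=> mC UVC E mE.
have mUV : measurable_fun setT (fun w => (U w, V w)).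
  exact: measurable_fun_pair.
have PCfin : P C \is a fin_num by rewrite fin_num_measure.
have c0 : (0 <= fine (P C))%R by rewrite fine_ge0.
pose c := NngNum c0.
have cE : P C = c%:num%:E by rewrite fineK.
(* Scaling one marginal by [P C] turns the right side into a product measure, with which both sides
   are compared. *)
pose m1 : {finite_measure set R -> \bar R} := mscale c (distribution P U).
pose m : {measure set (R * R) -> \bar R} :=
  mscale c (distribution P U \x distribution P V).
pose m0 : {measure set (R * R) -> \bar R} :=
  pushforward (mrestr P mC) (fun w => (U w, V w)).
pose m' := m0 mUV.
have Em : (m1 \x distribution P V) E = m E.
  apply: product_measure_unique => // A B mA mB.
  by rewrite /m /m1/= /mscale/= product_measure1E// muleA.
have Em' : (m1 \x distribution P V) E = m' E.
  apply: product_measure_unique => // A B mA mB.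
  transitivity (P (U @^-1` A `&` V @^-1` B `&` C)); first by [].
  by rewrite UVC// cE muleC muleA.
by rewrite muleC cE -[RHS]/(m E) -Em Em'.
Qed.

(** Tonelli for the joint law, pulled back to [T]: the variable [w'] provides an independent copy of
    [V] while [U w] is frozen. *)
Lemma fubini_joint_law (U V : {RV P >-> R}) (f : R * R -> \bar R) :
  (forall A B, measurable A -> measurable B ->
    P (U @^-1` A `&` V @^-1` B) = P (U @^-1` A) * P (V @^-1` B)) ->
  measurable_fun setT f -> (forall z, 0 <= f z) ->
  \int[P]_w f (U w, V w) = \int[P]_w \int[P]_w' f (U w, V w').
Proof.
move=> UV mf f0.
have mUV : measurable_fun setT (fun w => (U w, V w)).
  exact: measurable_fun_pair.
rewrite -(@ge0_integral_pushforward _ _ _ _ _ _ mUV P setT)//.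
rewrite (eq_measure_integral (distribution P U \x distribution P V)).
  rewrite fubini_tonelli1//.
  rewrite -[RHS]/(\int[P]_w ((fun u => \int[P]_w' f (u, V w')) \o U) w).
  rewrite -ge0_integral_distribution.
  - apply: eq_integral => u _; rewrite /fubini_F ge0_integral_distribution//.
    exact: measurableT_comp.
  - rewrite [X in measurable_fun _ X](_ : _ =
        fubini_F (distribution P V) f); last first.
      apply/funext => u; rewrite /fubini_F ge0_integral_distribution//.
      exact: measurableT_comp.
    exact: measurable_fun_fubini_tonelli_F.
  - by move=> u; apply: integral_ge0.
move=> E mE _; have := @joint_law U V setT measurableT _ E mE.
rewrite setIT probability_setT mule1; apply => A B mA mB.
by rewrite setIT mule1 UV.
Qed.

End independence.

(** * Partial sums of independent variables *)

Section partial_sums.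
Context {R : realType} d (T : measurableType d) (P : probability T R).
Variables (n : nat) (X : 'I_n -> {RV P >-> R}).

Definition psum (k : nat) (w : T) : R := \sum_(i < n | (i < k)%N) X i w.

Lemma measurable_psum k : measurable_fun setT (psum k).
Proof.
rewrite /psum; under eq_fun do rewrite big_mkcond.
by apply: measurable_sum => i; case: (i < k)%N.
Qed.

HB.instance Definition _ k :=
  isMeasurableFun.Build _ _ _ _ (psum k) (measurable_psum k).

Lemma psum0 w : psum 0 w = 0.
Proof. by rewrite /psum big_pred0. Qed.

Lemma psumS (k : 'I_n) w : psum k.+1 w = psum k w + X k w.
Proof.
rewrite /psum (bigD1 k) ?ltnS//= addrC; congr (_ + _); apply: eq_bigl => i.
by rewrite ltnS andbC -(inj_eq val_inj) -ltn_neqAle.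
Qed.

Lemma psum_all w : psum n w = \sum_(i < n) X i w.
Proof. by apply: eq_bigl => i; rewrite ltn_ord. Qed.

Hypothesis hind : mutually_independent X.

Let event (J : {set 'I_n}) (A : 'I_n -> set R) :=
  \bigcap_(i in [set` J]) (X i @^-1` A i).

Let measurable_event (J : {set 'I_n}) (A : 'I_n -> set R) :
  (forall i, i \in J -> measurable (A i)) -> measurable (event J A).
Proof.
move=> mA; apply: fin_bigcap_measurable => // i /= iJ.
by rewrite -[X in measurable X]setTI; apply: measurable_funP => //; exact: mA.
Qed.

(** Induction on [k], with [J] general: the induction hypothesis for [J] enlarged by [k] gives the
    rectangles in [psum k] and [X k], and [joint_law] passes from these to the event on their
    sum. *)
Lemma psum_indep k (J : {set 'I_n}) (A : 'I_n -> set R) (B : set R) :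
  (k <= n)%N -> (forall i, i \in J -> (k <= i)%N) ->
  (forall i, i \in J -> measurable (A i)) -> measurable B ->
  P (psum k @^-1` B `&` \bigcap_(i in [set` J]) (X i @^-1` A i)) =
  (P (psum k @^-1` B) * \prod_(i in J) P (X i @^-1` A i))%E.
Proof.
elim: k J A B => [|k IH] J A B kn kJ mA mB.
  (* The empty sum is the constant 0, so its preimage of [B] is everything or nothing. *)
  have [B0|B0] := pselect (B 0).
    have -> : psum 0 @^-1` B = setT.
      by apply/seteqP; split => // w _; rewrite /preimage/= psum0.
    by rewrite setTI probability_setT mul1e; exact: hind.
  have -> : psum 0 @^-1` B = set0.
    by apply/seteqP; split => // w; rewrite /preimage/= psum0.
  by rewrite set0I measure0 mul0e.
pose kk := Ordinal kn.
have kNJ (J' : {set 'I_n}) : (forall i, i \in J' -> (k < i)%N) -> kk \notin J'.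
  by move=> kJ'; apply/negP => /kJ'; rewrite ltnn.
have rect (J' : {set 'I_n}) B1 B2 : (forall i, i \in J' -> (k < i)%N) ->
    (forall i, i \in J' -> measurable (A i)) ->
    measurable B1 -> measurable B2 ->
    P (psum k @^-1` B1 `&` X kk @^-1` B2 `&` event J' A) =
    (P (psum k @^-1` B1) * P (X kk @^-1` B2) * P (event J' A))%E.
  move=> kJ' mA' mB1 mB2.
  pose A' i := if i == kk then B2 else A i.
  have A'E i : i \in J' -> A' i = A i.
    by rewrite /A'; case: eqP => // ->; rewrite (negbTE (kNJ _ kJ')).
  have A'kk : A' kk = B2 by rewrite /A' eqxx.
  have := IH (kk |: J') A' B1 (ltnW kn) _ _ mB1.
  rewrite big_setU1 ?kNJ//= A'kk muleA.
  have -> : P (event J' A) = (\prod_(i in J') P (X i @^-1` A i))%E.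
    exact: hind.
  have -> : (\prod_(i in J') P (X i @^-1` A' i) =
             \prod_(i in J') P (X i @^-1` A i))%E.
    by apply: eq_bigr => i iJ; rewrite A'E.
  move=> <-.
  - congr (P _); rewrite -setIA; congr (_ `&` _); apply/seteqP; split => w.
    + move=> [wk wJ] i /=; rewrite in_setU1 => /predU1P[->|iJ].
        by rewrite A'kk.
      by rewrite A'E//; exact: wJ.
    + move=> wJ; split; first by rewrite -A'kk; apply: wJ; rewrite /= setU11.
      by move=> i /= iJ; rewrite -A'E//; apply: wJ; rewrite /= setU1r.
  - by move=> i; rewrite in_setU1 => /predU1P[->//|/kJ'/ltnW].
  - move=> i; rewrite in_setU1 => /predU1P[->|iJ]; first by rewrite A'kk.
    by rewrite A'E//; exact: mA'.
pose E : set (R * R) := (fun z => z.1 + z.2) @^-1` B.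
have mE : measurable E.
  rewrite -[E]setTI; apply: (measurable_funD _ _ measurableT) => //.
have preE : psum k.+1 @^-1` B = (fun w => (psum k w, X kk w)) @^-1` E.
  by apply/seteqP; split => w; rewrite /preimage /E/= (psumS kk).
have r0 B1 B2 : measurable B1 -> measurable B2 ->
    P (psum k @^-1` B1 `&` X kk @^-1` B2 `&` setT) =
    (P (psum k @^-1` B1) * P (X kk @^-1` B2) * P setT)%E.
  move=> mB1 mB2; have := rect finset.set0 B1 B2.
  rewrite /event (_ : [set` finset.set0] = set0); last first.
    by apply/seteqP; split => i //=; rewrite finset.in_set0.
  by rewrite bigcap_set0; apply => // i; rewrite finset.in_set0.
have jl := @joint_law _ _ _ P (psum k) (X kk).
have mJ := measurable_event mA.
rewrite preE (jl _ mJ)//; last by move=> B1 B2 mB1 mB2; exact: rect.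
have := jl setT measurableT r0 E mE.
by rewrite setIT probability_setT mule1 => ->; rewrite (@hind J A).
Qed.

End partial_sums.

(** * Iterated replacement of the summands *)

Section lindeberg.
Context {R : realType} d (T : measurableType d) (P : probability T R).
Variables (n : nat) (X : 'I_n -> {RV P >-> R}) (beta : R).
Hypothesis hind : mutually_independent X.
Hypothesis hmean : forall i : 'I_n, ('E_P[X i] <= 0)%E.
Hypothesis hvar : (\sum_(i < n) 'E_P[fun w => (X i w ^+ 2)%R] <= 1)%E.
Hypothesis hthird : (\sum_(i < n) 'E_P[fun w => (pospart (X i w) ^+ 3)%R]
  <= beta%:E)%E.

(** Nonnegative terms with a finite sum are finite, so the moments can be handled as real
    numbers. *)
Lemma sum_fine_le (f : 'I_n -> \bar R) (c : R) :
  (forall i, 0 <= f i)%E -> (\sum_(i < n) f i <= c%:E)%E ->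
  (forall i, f i = (fine (f i))%:E) /\ \sum_(i < n) fine (f i) <= c.
Proof.
move=> f0 fc.
have fE i : f i = (fine (f i))%:E.
  rewrite fineK// ge0_fin_numE// (le_lt_trans _ (ltry c))//.
  apply: le_trans fc; rewrite (bigD1 i)//= leeDl// sume_ge0//.
split => //; rewrite -lee_fin; apply: le_trans fc.
by rewrite -sumEFin; apply: lee_sum => i _; rewrite -fE.
Qed.

Let s i := fine 'E_P[fun w => (X i w ^+ 2)%R].
Let b i := fine 'E_P[fun w => (pospart (X i w) ^+ 3)%R].

Let sP : (forall i, 'E_P[fun w => (X i w ^+ 2)%R] = (s i)%:E)%E
  /\ \sum_(i < n) s i <= 1.
Proof.
by apply: sum_fine_le => // i; apply: expectation_ge0 => w; exact: sqr_ge0.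
Qed.

Let bP : (forall i, 'E_P[fun w => (pospart (X i w) ^+ 3)%R] = (b i)%:E)%E
  /\ \sum_(i < n) b i <= beta.
Proof.
apply: sum_fine_le => // i; apply: expectation_ge0 => w.
by rewrite exprn_ge0 ?pospart_ge0.
Qed.

Let s_ge0 i : 0 <= s i.
Proof. by rewrite fine_ge0 ?expectation_ge0// => w; exact: sqr_ge0. Qed.

Let b_ge0 i : 0 <= b i.
Proof.
by rewrite fine_ge0 ?expectation_ge0// => w; rewrite exprn_ge0 ?pospart_ge0.
Qed.

(** One replacement: by independence [X k] is averaged with [psum X k] frozen, and
    [expectation_gauss3_le] turns it into Gaussian variance [s k]. *)
Lemma psum_step (k : 'I_n) (a t : R) : 0 <= t ->
  ('E_P[fun w => gauss3 (a + psum X k.+1 w) t]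
     <= 'E_P[fun w => gauss3 (a + psum X k w) (Num.sqrt (t ^+ 2 + s k))]
        + (b k)%:E)%E.
Proof.
move=> t0.
have mg (r : R) : measurable_fun setT (fun z : R => (gauss3 (a + z) r)%:E).
  apply/measurable_EFinP; apply: (measurableT_comp (measurable_gauss3 r)).
  exact: measurable_funD.
have mps k' : measurable_fun setT (psum X k') by exact: measurable_psum.
rewrite unlock.
under eq_integral do rewrite psumS addrA.
pose f (z : R * R) := (gauss3 (a + z.1 + z.2) t)%:E.
have mf : measurable_fun setT f.
  apply/measurable_EFinP; apply: (measurableT_comp (measurable_gauss3 t)).
  by apply: measurable_funD => //; apply: measurable_funD.
have f0 z : (0 <= f z)%E by rewrite lee_fin gauss3_ge0.
rewrite -[leLHS]/(\int[P]_w f (psum X k w, X k w))%E.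
rewrite (@fubini_joint_law _ _ _ P (psum X k) (X k))//; last first.
  move=> A B mA mB.
  have := psum_indep hind (J := [set k]%SET) (A := fun=> B) (ltnW (ltn_ord k))
    _ _ mA.
  rewrite big_set1 (_ : \bigcap_(i in [set` [set k]%SET]) _ = X k @^-1` B).
    by apply => // i; rewrite finset.in_set1 => /eqP ->.
  apply/seteqP; split => w; first by apply; rewrite /= finset.set11.
  by move=> wB i /=; rewrite finset.in_set1 => /eqP ->.
have int0 (r : R) : 0 <= r ->
    (0 <= \int[P]_w (gauss3 (a + psum X k w) r)%:E)%E.
  by move=> r0; apply: integral_ge0 => w _; rewrite lee_fin gauss3_ge0.
apply: (@le_trans _ _ (\int[P]_w
    ((gauss3 (a + psum X k w) (Num.sqrt (t ^+ 2 + s k)))%:E + (b k)%:E))%E).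
  apply: ge0_le_integral => //.
  - by move=> w _; apply: integral_ge0.
  (* The inner integral is measurable in [w] as a section integral on [T * T]. *)
  - apply: (@measurable_fun_fubini_tonelli_F _ _ T T R P
      (fun z : T * T => f (psum X k z.1, X k z.2))).
    + apply: (measurableT_comp mf); apply: measurable_fun_pair;
        exact: measurableT_comp.
    + by move=> z; exact: f0.
  - apply: emeasurable_funD => //.
    exact: (measurableT_comp (mg _)).
  - move=> w _; rewrite -EFinD.
    have := expectation_gauss3_le (a + psum X k w) t0 (hmean k) (sP.1 k)
      (bP.1 k).
    by rewrite unlock.
rewrite ge0_integralD//.
- by have := expectation_cst P (b k); rewrite unlock => ->.
- by move=> w _; rewrite lee_fin gauss3_ge0 ?sqrtr_ge0.
- exact: (measurableT_comp (mg _)).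
- by move=> w _; rewrite lee_fin.
Qed.

(** The Gaussian variance accumulated once the summands of index at least [k] are replaced. *)
Let v k := \sum_(i < n | (k <= i)%N) s i.

Let sum_tail (f : 'I_n -> R) (k : 'I_n) :
  \sum_(i < n | (k <= i)%N) f i = \sum_(i < n | (k < i)%N) f i + f k.
Proof.
rewrite (bigD1 k)//= addrC; congr (_ + _); apply: eq_bigl => i.
by rewrite ltn_neqAle andbC (inj_eq val_inj) eq_sym.
Qed.

Let v_ge0 k : 0 <= v k.
Proof. by apply: sumr_ge0. Qed.

Lemma psum_induction (a : R) k : (k <= n)%N ->
  ('E_P[fun w => (pospart (a + psum X n w) ^+ 3)%R]
   <= 'E_P[fun w => gauss3 (a + psum X k w) (Num.sqrt (v k))]
      + (\sum_(i < n | (k <= i)%N) b i)%:E)%E.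
Proof.
(* Descending induction from [k = n], where nothing is replaced and the Gaussian scale is 0. *)
move=> kn; rewrite -(subKn kn); elim: (n - k)%N => [|m IH].
  have nbig (f : 'I_n -> R) : \sum_(i < n | (n <= i)%N) f i = 0.
    by apply: big_pred0 => i; rewrite leqNgt ltn_ord.
  rewrite subn0 /v !nbig sqrtr0 adde0 le_eqVlt; apply/orP; left; apply/eqP.
  by congr expectation; apply/funext => w; rewrite /gauss3 eqxx.
(* Subtraction is truncated: if [n <= m], both indices are 0 and the claim is [IH]. *)
have [nm|mn] := leqP n m.
  have /eqP nm1 : (n - m.+1 == 0)%N by rewrite subn_eq0 leqW.
  by rewrite nm1; move: IH; have /eqP -> : (n - m == 0)%N by rewrite subn_eq0.
have kln : (n - m.+1 < n)%N by rewrite -subn_gt0 subKn.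
pose kk := Ordinal kln.
have kE : (n - m)%N = kk.+1 by rewrite /= -subSn// subSS.
apply: le_trans IH _; rewrite kE -[(n - m.+1)%N]/(kk : nat).
apply: le_trans (leeD2r _ (psum_step kk a (sqrtr_ge0 _))) _.
rewrite sqr_sqrtr// -sum_tail -addeA -EFinD.
by rewrite [b kk + _]addrC -sum_tail.
Qed.

(** At [k = 0] every summand is replaced, and the total variance [v 0 <= 1] may be raised to 1. *)
Lemma expectation_pospart_cube_le (a : R) :
  ('E_P[fun w => (pospart (\sum_(i < n) X i w + a) ^+ 3)%R]
   <= (gpos3 a + beta)%:E)%E.
Proof.
have := psum_induction a (leq0n n).
rewrite (_ : (fun w => gauss3 (a + psum X 0 w) _) =
    cst (gauss3 a (Num.sqrt (v 0)))).
  rewrite expectation_cst -EFinD; under eq_fun do rewrite psum_all addrC.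
  move/le_trans; apply; rewrite lee_fin lerD//; last exact: bP.2.
  apply: gauss3_le_gpos3; first exact: sqrtr_ge0.
  by rewrite -sqrtr1 ler_wsqrtr// sP.2.
by apply/funext => w; rewrite psum0 addr0.
Qed.

End lindeberg.

(** * Numerical bounds *)

Section numerical_bounds.
Context {R : realType}.
Implicit Types x y u : R.

Lemma deriv_le_le (f g df dg : R -> R) x : 0 <= x ->
  (forall z, has_deriv f z (df z)) -> (forall z, has_deriv g z (dg z)) ->
  (forall z, 0 <= z -> df z <= dg z) -> f 0 = g 0 -> f x <= g x.
Proof.
move=> x0 fdf gdg dfg fg0; rewrite -subr_ge0.
have -> : 0 = g 0 - f 0 by rewrite fg0 subrr.
apply: (@deriv_ge0_le _ (fun z => g z - f z) (fun z => dg z - df z))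
  => // z z0 _.
  by apply: has_derivD; [exact: gdg|apply: has_derivN; exact: fdf].
by rewrite subr_ge0 dfg.
Qed.

(** If [pi / 4 < 785 / 1000], then [cos (785 / 1000) < cos (pi / 4) = 0.70710...], against the lower
    bound 0.7073 from the Taylor polynomial of degree 6. The Taylor bounds come from repeated
    integration of [cos <= 1]. *)
Lemma pi_ge314 : 314 / 100 <= pi :> R.
Proof.
have pbnd (p : R) : 2 <= p -> p < 314 / 100 ->
    [/\ (0 : R) <= 785 / 1000, 785 / 1000 <= p, 0 <= p / 4, p / 4 <= p
      & p / 4 < 785 / 1000].
  by move=> p2 p3; split; lra.
have ds (z : R) : has_deriv sin z (cos z) by exact: is_derive_sin.
have dc (z : R) : has_deriv cos z (- sin z) by exact: is_derive_cos.
have s1 x : 0 <= x -> sin x <= x.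
  move=> x0; apply: (@deriv_le_le sin id cos (fun=> 1)) => [|||z _|].
  - exact: x0.
  - exact: ds.
  - by move=> z; exact: has_deriv_id.
  - exact: cos_le1.
  - exact: sin0.
have c2 x : 0 <= x -> 1 - x ^+ 2 / 2 <= cos x.
  move=> x0; apply: (@deriv_le_le
    (fun x => 1 - x ^+ 2 / 2) cos
    (fun x => - x) (fun x => - sin x)).
  - exact: x0.
  - by move=> z; apply: has_deriv_eq; [derive_rules|rewrite /=; field].
  - exact: dc.
  - by move=> z z0; rewrite lerN2; exact: s1.
  - by rewrite cos0; field.
have s3 x : 0 <= x -> x - x ^+ 3 / 6 <= sin x.
  move=> x0; apply: (@deriv_le_le
    (fun x => x - x ^+ 3 / 6) sin
    (fun x => 1 - x ^+ 2 / 2) cos).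
  - exact: x0.
  - by move=> z; apply: has_deriv_eq; [derive_rules|rewrite /=; field].
  - exact: ds.
  - exact: c2.
  - by rewrite sin0; field.
have c4 x : 0 <= x -> cos x <= 1 - x ^+ 2 / 2 + x ^+ 4 / 24.
  move=> x0; apply: (@deriv_le_le
    cos (fun x => 1 - x ^+ 2 / 2 + x ^+ 4 / 24)
    (fun x => - sin x) (fun x => - (x - x ^+ 3 / 6))).
  - exact: x0.
  - exact: dc.
  - by move=> z; apply: has_deriv_eq; [derive_rules|rewrite /=; field].
  - by move=> z z0; rewrite lerN2; exact: s3.
  - by rewrite cos0; field.
have s5 x : 0 <= x -> sin x <= x - x ^+ 3 / 6 + x ^+ 5 / 120.
  move=> x0; apply: (@deriv_le_le
    sin (fun x => x - x ^+ 3 / 6 + x ^+ 5 / 120)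
    cos (fun x => 1 - x ^+ 2 / 2 + x ^+ 4 / 24)).
  - exact: x0.
  - exact: ds.
  - by move=> z; apply: has_deriv_eq; [derive_rules|rewrite /=; field].
  - exact: c4.
  - by rewrite sin0; field.
have c6 x : 0 <= x -> 1 - x ^+ 2 / 2 + x ^+ 4 / 24 - x ^+ 6 / 720 <= cos x.
  move=> x0; apply: (@deriv_le_le
    (fun x => 1 - x ^+ 2 / 2 + x ^+ 4 / 24 - x ^+ 6 / 720) cos
    (fun x => - (x - x ^+ 3 / 6 + x ^+ 5 / 120)) (fun x => - sin x)).
  - exact: x0.
  - by move=> z; apply: has_deriv_eq; [derive_rules|rewrite /=; field].
  - exact: dc.
  - by move=> z z0; rewrite lerN2; exact: s5.
  - by rewrite cos0; field.
have cx : 7073 / 10000 <= cos (785 / 1000) :> R.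
  by apply: le_trans (c6 (785 / 1000) _); lra.
rewrite leNgt; apply/negP => pi_lt.
have [x0 xpi q0 qpi lt785] := pbnd _ (@pi_ge2 R) pi_lt.
have : cos (785 / 1000) < cos (pi / 4) :> R.
  by rewrite ltr_cos// in_itv; apply/andP.
have := cos_mulr2n (pi / 4 : R).
rewrite (_ : pi / 4 *+ 2 = pi / 2) ?cos_pihalf; last first.
  by rewrite -mulr_natr; field.
rewrite -mulr_natr; move: cx; move: (cos _) (cos (pi / 4)) => c c'.
clear; nra.
Qed.

Lemma gpdf0E : gpdf 0 = (Num.sqrt (pi *+ 2))^-1 :> R.
Proof.
rewrite /gpdf normal_pdfE ?oner_neq0// /normal_fun subrr expr0n/= oppr0 mul0r.
by rewrite expR0 mulr1 /normal_peak expr1n mul1r.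
Qed.

(** From [pi >= 3.14], as [1 / sqrt 6.28 = 0.39904...] and [499 / 1250 = 0.3992]. *)
Lemma gpdf0_le : gpdf 0 <= 499 / 1250 :> R.
Proof.
have s0 : 0 < Num.sqrt (pi *+ 2) :> R by rewrite sqrtr_gt0 mulrn_wgt0// pi_gt0.
rewrite gpdf0E -(ler_pM2r s0) mulVf ?gt_eqF//.
have : Num.sqrt (pi *+ 2) ^+ 2 = pi * 2 :> R.
  by rewrite sqr_sqrtr ?mulr_natr// mulrn_wge0// pi_ge0.
move: s0 pi_ge314; move: (Num.sqrt _) => s; move: pi => p; clear; nra.
Qed.

(* [k!^-1], as a product so that it never computes with unary factorials *)
Definition inv_fact (k : nat) : R := \prod_(j < k) j.+1%:R^-1.

Lemma inv_factS k : inv_fact k.+1 = inv_fact k / k.+1%:R.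
Proof. by rewrite /inv_fact big_ord_recr. Qed.

Lemma inv_fact0 : inv_fact 0 = 1. Proof. by rewrite /inv_fact big_ord0. Qed.

Definition expN_taylor (N : nat) u : R := \sum_(k < N) (- u) ^+ k * inv_fact k.

(** Termwise integral over [z] from 0 to [y] of [expN_taylor N (z ^ 2 / 2)]. *)
Definition gint_taylor (N : nat) y : R :=
  \sum_(k < N) (- 2^-1) ^+ k * y ^+ k.*2.+1 * inv_fact k / k.*2.+1%:R.

Lemma has_deriv_expN_taylor N u :
  has_deriv (expN_taylor N.+1) u (- expN_taylor N u).
Proof.
elim: N => [|N IH].
  rewrite [X in has_deriv X](_ : _ = fun=> 1); last first.
    by apply/funext => v; rewrite /expN_taylor big_ord1 expr0 inv_fact0 mulr1.
  by rewrite /expN_taylor big_ord0 oppr0; exact: has_deriv_cst.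
rewrite [X in has_deriv X](_ : _ = fun v =>
    expN_taylor N.+1 v + (- v) ^+ N.+1 * inv_fact N.+1); last first.
  by apply/funext => v; rewrite /expN_taylor big_ord_recr.
apply: has_deriv_eq; first by derive_rules.
rewrite /= {2}/expN_taylor big_ord_recr/= -/(expN_taylor N u) opprD mulr0 add0r.
congr (_ + _); rewrite inv_factS; field.
by rewrite nat1r pnatr_eq0.
Qed.

Lemma has_deriv_gint_taylor N y :
  has_deriv (gint_taylor N) y (expN_taylor N (y ^+ 2 / 2)).
Proof.
elim: N => [|N IH].
  rewrite [X in has_deriv X](_ : _ = fun=> 0); last first.
    by apply/funext => v; rewrite /gint_taylor big_ord0.
  by rewrite /expN_taylor big_ord0; exact: has_deriv_cst.
rewrite [X in has_deriv X](_ : _ = fun v => gint_taylor N v +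
    (- 2^-1) ^+ N * v ^+ N.*2.+1 * inv_fact N / N.*2.+1%:R); last first.
  by apply/funext => v; rewrite /gint_taylor big_ord_recr.
apply: has_deriv_eq; first by derive_rules.
rewrite /expN_taylor big_ord_recr/= -/(expN_taylor N _); congr (_ + _).
rewrite (_ : - (y ^+ 2 / 2) = - 2^-1 * y ^+ 2); last by rewrite mulNr mulrC.
rewrite exprMn -exprM mul2n; field.
by rewrite nat1r pnatr_eq0.
Qed.

(** The signed remainder vanishes at 0 and its derivative is the signed remainder with one term
    fewer. So an odd number of terms overestimates [expR (- u)]. *)
Lemma expN_taylorP N u : 0 <= u ->
  0 <= (-1) ^+ N * (expR (- u) - expN_taylor N u).
Proof.
have de (z : R) : has_deriv expR z (expR z) by exact: has_deriv_expR.
elim: N u => [|N IH] u u0.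
  by rewrite /expN_taylor big_ord0 subr0 mul1r expR_ge0.
pose g v := (-1) ^+ N.+1 * (expR (- v) - expN_taylor N.+1 v).
have dt v := has_deriv_expN_taylor N v.
have dg v : has_deriv g v ((-1) ^+ N * (expR (- v) - expN_taylor N v)).
  by rewrite /g; apply: has_deriv_eq; [derive_rules|rewrite exprS; ring].
have g0 : g 0 = 0.
  rewrite /g oppr0 expR0 /expN_taylor big_ord_recl expr0 inv_fact0 mulr1.
  rewrite big1 ?addr0.
    by rewrite subrr mulr0.
  by move=> i _; rewrite oppr0 expr0n mul0r.
rewrite -/(g u) -g0; apply: (deriv_ge0_le (fun z _ _ => dg z)) => // z z0 _.
exact: IH.
Qed.

Lemma expN_le_taylor N u : 0 <= u -> expR (- u) <= expN_taylor N.*2.+1 u.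
Proof.
move=> u0; have := expN_taylorP N.*2.+1 u0.
by rewrite -signr_odd /= odd_double expr1 mulN1r oppr_ge0 subr_le0.
Qed.

Lemma gpdf_le_taylor N y : gpdf y <= gpdf 0 * expN_taylor N.*2.+1 (y ^+ 2 / 2).
Proof.
by rewrite gpdfE ler_wpM2l ?gpdf_ge0// expN_le_taylor// divr_ge0// sqr_ge0.
Qed.

Lemma gcdf0 : gcdf 0 = 1 / 2 :> R.
Proof. by have := gcdfN (0 : R); rewrite oppr0; move: (gcdf 0) => c; lra. Qed.

Lemma gcdf_le_taylor N y : 0 <= y ->
  gcdf y <= 1 / 2 + gpdf 0 * gint_taylor N.*2.+1 y.
Proof.
move=> y0; apply: (@deriv_le_le gcdf
  (fun y => 1 / 2 + gpdf 0 * gint_taylor N.*2.+1 y) gpdf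
  (fun y => gpdf 0 * expN_taylor N.*2.+1 (y ^+ 2 / 2))).
- exact: y0.
- exact: has_deriv_gcdf.
- move=> z; have := has_deriv_gint_taylor N.*2.+1 z.
  move: (gint_taylor _) => f df.
  by apply: has_deriv_eq; [derive_rules|rewrite add0r mulr0 addr0].
- by move=> z _; exact: gpdf_le_taylor.
- rewrite gcdf0 /gint_taylor big1 ?mulr0 ?addr0// => i _.
  by rewrite expr0n/= mulr0 !mul0r.
Qed.

Lemma gpos3_le_taylor N y : 0 <= y ->
  gpos3 y <= (y ^+ 3 + 3 * y) / 2 + gpdf 0 *
    ((y ^+ 3 + 3 * y) * gint_taylor N.*2.+1 y
     + (y ^+ 2 + 2) * expN_taylor N.*2.+1 (y ^+ 2 / 2)).
Proof.
move=> y0; rewrite /gpos3.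
have c1 : 0 <= y ^+ 3 + 3 * y by rewrite addr_ge0 ?mulr_ge0 ?exprn_ge0.
have c2 : 0 <= y ^+ 2 + 2 by rewrite addr_ge0 ?sqr_ge0.
have := lerD (ler_wpM2l c1 (gcdf_le_taylor N y0))
  (ler_wpM2l c2 (gpdf_le_taylor N y)).
move=> /le_trans; apply; rewrite le_eqVlt; apply/orP; left; apply/eqP.
by move: (gpdf 0) (gint_taylor _ _) (expN_taylor _ _) => p g e; field.
Qed.

(** Horner form, for evaluation at a rational point by [lra]. *)
Lemma expN_taylor9E u : expN_taylor 9 u = 1 - u * (1 - u / 2 * (1 - u / 3 *
  (1 - u / 4 * (1 - u / 5 * (1 - u / 6 * (1 - u / 7 * (1 - u / 8))))))).
Proof.
rewrite /expN_taylor !big_ord_recr big_ord0 /= !inv_factS inv_fact0.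
by field.
Qed.

Lemma gint_taylor9E y : gint_taylor 9 y = y * (1 - y ^+ 2 / 2 * (1 / 3
  - y ^+ 2 / 4 * (1 / 5 - y ^+ 2 / 6 * (1 / 7 - y ^+ 2 / 8 * (1 / 9
  - y ^+ 2 / 10 * (1 / 11 - y ^+ 2 / 12 * (1 / 13 - y ^+ 2 / 14 * (1 / 15
  - y ^+ 2 / 16 / 17)))))))).
Proof.
rewrite /gint_taylor !big_ord_recr big_ord0 /= !inv_factS inv_fact0.
by rewrite !doubleS double0; field.
Qed.

(** The sign hypotheses make the factor of [gpdf 0] nonnegative, so that [gpdf 0] can be replaced by
    its upper bound. *)
Lemma gpos3_le_taylor9 y : 0 <= y -> 0 <= gint_taylor 9 y ->
  0 <= expN_taylor 9 (y ^+ 2 / 2) ->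
  gpos3 y <= (y ^+ 3 + 3 * y) / 2 + 499 / 1250 *
    ((y ^+ 3 + 3 * y) * gint_taylor 9 y
     + (y ^+ 2 + 2) * expN_taylor 9 (y ^+ 2 / 2)).
Proof.
move=> y0 g0 e0; apply: le_trans (gpos3_le_taylor 4 y0) _.
rewrite lerD2l ler_wpM2r ?gpdf0_le// addr_ge0// mulr_ge0//.
  by rewrite addr_ge0 ?mulr_ge0 ?exprn_ge0.
by rewrite addr_ge0 ?sqr_ge0.
Qed.

(** Times [4 / 27 / (1746 / 1000) ^ 2], this bound stays just below [514 / 1000]. *)
Lemma gpos3_1746_le : gpos3 (1746 / 1000) <= 21153 / 2000 :> R.
Proof.
apply: le_trans (gpos3_le_taylor9 _ _ _) _;
  rewrite ?expN_taylor9E ?gint_taylor9E; lra.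
Qed.

(** Times [4 / 27 / (639 / 1000)], this bound stays just below [555 / 1000]. *)
Lemma gpos3_639_le : gpos3 (639 / 1000) <= 4787 / 2000 :> R.
Proof.
apply: le_trans (gpos3_le_taylor9 _ _ _) _;
  rewrite ?expN_taylor9E ?gint_taylor9E; lra.
Qed.

End numerical_bounds.

(** * Moments of the positive part of a sum *)

Section truncated_moments.
Context {R : realType}.
Implicit Types p a x : R.

Definition moment_cst p : R := p `^ p * (3 - p) `^ (3 - p) / 3 ^+ 3.

Lemma moment_cst_ge0 p : 0 <= moment_cst p.
Proof. by rewrite /moment_cst divr_ge0 ?mulr_ge0 ?powR_ge0 ?exprn_ge0. Qed.

Lemma powR_pospart_le p a x : 0 < p -> p < 3 -> 0 < a ->
  pospart x `^ p <= moment_cst p * (pospart (x + a) ^+ 3 / a `^ (3 - p)).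
Proof.
move=> p0 p3 a0.
have a3 : 0 < a `^ (3 - p) by rewrite powR_gt0.
have [x0|x0] := leP x 0.
  rewrite {1}/pospart max_l// powR0 ?gt_eqF//.
  by rewrite mulr_ge0 ?moment_cst_ge0// divr_ge0 ?exprn_ge0 ?pospart_ge0 ?ltW.
have q0 : 0 < 3 - p by rewrite subr_gt0.
rewrite /pospart max_r ?(ltW x0)// max_r ?addr_ge0 ?(ltW x0) ?(ltW a0)//.
(* weighted AM-GM for [x / p] and [a / (3 - p)] with weights [p / 3] and
   [(3 - p) / 3] *)
pose A := (x / p) `^ (p / 3); pose B := (a / (3 - p)) `^ ((3 - p) / 3).
have AB : A * B <= (x + a) / 3.
  have := @conjugate_powR R A B (3 / p) (3 / (3 - p))
    (powR_ge0 _ _) (powR_ge0 _ _).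
  rewrite !divr_gt0// -!powRrM => /(_ isT isT).
  have -> : p / 3 * (3 / p) = 1 by field; rewrite gt_eqF.
  have -> : (3 - p) / 3 * (3 / (3 - p)) = 1 by field; rewrite gt_eqF.
  rewrite !powRr1 ?divr_ge0 ?(ltW x0) ?(ltW p0) ?(ltW a0) ?(ltW q0)//.
  move=> /(_ _)/le_trans; apply.
    by field; rewrite !gt_eqF.
  by rewrite le_eqVlt; apply/orP; left; apply/eqP; field; rewrite !gt_eqF.
have cube c q : (c `^ (q / 3)) ^+ 3 = c `^ q :> R.
  by rewrite -powR_mulrn ?powR_ge0// -powRrM; congr (_ `^ _); field.
have := @lerXn2r R 3 (A * B) ((x + a) / 3).
rewrite !nnegrE mulr_ge0 ?powR_ge0// divr_ge0 ?addr_ge0 ?(ltW x0) ?(ltW a0)//.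
move=> /(_ isT isT AB).
rewrite exprMn !cube => le3.
(* Undo the normalization by [p] and [3 - p] in the cubed inequality [le3]; this produces
   [moment_cst p]. *)
have xE : x `^ p = (x / p) `^ p * p `^ p.
  by rewrite -powRM ?divr_ge0 ?(ltW x0) ?(ltW p0)// divfK// gt_eqF.
have aE : a `^ (3 - p) = (a / (3 - p)) `^ (3 - p) * (3 - p) `^ (3 - p).
  by rewrite -powRM ?divr_ge0 ?(ltW a0) ?(ltW q0)// divfK// gt_eqF.
rewrite mulrA ler_pdivlMr// xE aE mulrACA /moment_cst mulrC.
rewrite -[leRHS]mulrA; apply: ler_wpM2l; first by rewrite mulr_ge0 ?powR_ge0.
by apply: le_trans le3 _; rewrite expr_div_n mulrC.
Qed.

End truncated_moments.

Theorem corollary2 (R : realType)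
    (d : measure_display) (T : measurableType d) (P : probability T R)
    (d' : measure_display) (T' : measurableType d') (Q : probability T' R)
    (Z : {RV Q >-> R}) (hZ : standard_normal Z)
    (beta : R) (hbeta : 0 < beta)
    (n : nat) (X : 'I_n -> {RV P >-> R})
    (hind : mutually_independent X)
    (hmean : forall i : 'I_n, ('E_P[X i] <= 0)%E)
    (hvar : (\sum_(i < n) 'E_P[fun w => (X i w ^+ 2)%R] <= 1)%E)
    (hthird : (\sum_(i < n) 'E_P[fun w => (pospart (X i w) ^+ 3)%R]
                 <= beta%:E)%E) :
  let S : T -> R := fun w => \sum_(i < n) X i w in
  [/\ forall p a : R, 0 < p -> p < 3 -> 0 < a ->
        ('E_P[fun w => (pospart (S w) `^ p)%R]
           <= (p `^ p * (3 - p) `^ (3 - p) / 3 ^+ 3)%:E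
              * (('E_Q[fun w => (pospart (Z w + a) ^+ 3)%R] + beta%:E)
                 * ((a `^ (3 - p))^-1)%:E))%E,
      ('E_P[fun w => pospart (S w)]
         <= (514 / 1000 + 486 / 10000 * beta)%:E)%E
    & ('E_P[fun w => (pospart (S w) ^+ 2)%R]
         <= (555 / 1000 + 232 / 1000 * beta)%:E)%E].
Proof.
move=> S.
have mS : measurable_fun setT S by exact: measurable_sum.
have mpos (f : T -> R) : measurable_fun setT f ->
    measurable_fun setT (fun w => pospart (f w)).
  by move=> mf; exact: measurable_maxr.
(* Stated with the closed form [gpos3 a], which the two numerical bounds evaluate directly. *)
have moment p a : 0 < p -> p < 3 -> 0 < a ->
    ('E_P[fun w => (pospart (S w) `^ p)%R]
       <= (moment_cst p * ((gpos3 a + beta) / a `^ (3 - p)))%:E)%E.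
  move=> p0 p3 a0.
  have K0 : 0 <= moment_cst p / a `^ (3 - p).
    by rewrite divr_ge0 ?moment_cst_ge0 ?powR_ge0.
  have mSa : measurable_fun setT (fun w => pospart (S w + a) ^+ 3).
    by apply: measurable_funX; apply: mpos; exact: measurable_funD.
  have := lee_wpmul2l (_ : (0 <= (moment_cst p / a `^ (3 - p))%:E)%E)
    (expectation_pospart_cube_le hind hmean hvar hthird a).
  rewrite lee_fin => /(_ K0); rewrite -EFinM => leK.
  rewrite (_ : moment_cst p * _ =
      moment_cst p / a `^ (3 - p) * (gpos3 a + beta)); last first.
    by rewrite mulrA mulrAC.
  apply: le_trans leK; rewrite unlock -ge0_integralZl//; last 2 first.
  - exact/measurable_EFinP.
  - by move=> w _; rewrite lee_fin exprn_ge0 ?pospart_ge0.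
  apply: ge0_le_integral => //.
  - by move=> w _; rewrite lee_fin powR_ge0.
  - apply/measurable_EFinP; apply: (measurableT_comp (measurable_powR p)).
    exact: mpos.
  - by apply: measurable_funeM; exact/measurable_EFinP.
  - move=> w _; rewrite -EFinM lee_fin mulrAC -mulrA.
    exact: powR_pospart_le.
split.
- move=> p a p0 p3 a0; apply: le_trans (moment p a p0 p3 a0) _.
  rewrite EFinM; apply: lee_wpmul2l; first by rewrite lee_fin moment_cst_ge0.
  rewrite EFinM; apply: lee_wpmul2r; first by rewrite lee_fin invr_ge0 powR_ge0.
  by rewrite EFinD; apply: leeD2r; exact: gpos3_le_expectation.
- have a0 : 0 < 1746 / 1000 :> R by lra.
  have p3 : (1 : R) < 3 by lra.
  have := moment 1 (1746 / 1000) ltr01 p3 a0.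
  under eq_fun do rewrite powRr1 ?pospart_ge0//.
  move/le_trans; apply; rewrite lee_fin /moment_cst.
  have -> : 3 - 1 = 2%:R :> R by lra.
  rewrite powR1 !powR_mulrn ?(ltW a0)//.
  (* The coefficient of [beta > 0] is [4 / 27 / (1746 / 1000) ^ 2 < 486 / 10000]. *)
  have := @gpos3_1746_le R; move: (gpos3 _) hbeta => h; clear; lra.
- have a0 : 0 < 639 / 1000 :> R by lra.
  have p0 : (0 : R) < 2 by lra.
  have p3 : (2 : R) < 3 by lra.
  have := moment 2 (639 / 1000) p0 p3 a0.
  under eq_fun do rewrite (powR_mulrn 2) ?pospart_ge0//.
  move/le_trans; apply; rewrite lee_fin /moment_cst.
  have -> : 3 - 2 = 1 :> R by lra.
  rewrite powR1 powR_mulrn// powRr1 ?(ltW a0)//.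
  (* Likewise [4 / 27 / (639 / 1000) < 232 / 1000]. *)
  have := @gpos3_639_le R; move: (gpos3 _) hbeta => h; clear; lra.
Qed.
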